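(* Let $$Z(s)=\frac{a_3s^3+a_2s^2+a_1s+a_0}{d_3s^3+d_2s^2+d_1s+d_0}$$ be a positive-real function with $a_i,d_j\ge 0$ real for $i,j=0,1,2,3$ and McMillan degree $\delta(Z(s))=3$. If $Z(s)$ has a finite pole or a finite zero on $j\mathbb{R}\setminus\{0\}$, then $Z(s)$ is realizable as the impedance of a series-parallel network containing three energy storage elements and no more than two dampers.
   Context: All networks are two-terminal linear time-invariant networks consisting of dampers, springs and inerters with positive finite element values: a finite connected graph (multiple edges allowed) with two distinguished vertices $a,a'$ (the terminals), each edge being one element and, as usual, lying on some simple path from $a$ to $a'$. The impedance of a network is its driving-point impedance at the terminals, i.e. the ratio of the Laplace transform of the relative velocity across the terminals (role of voltage) to that of the force (role of current); a damper $c>0$ has impedance $1/c$, a spring $k>0$ has impedance $s/k$, an inerter $b>0$ has impedance $1/(bs)$. $Z(s)$ is realizable as a network if it equals the impedance of that network. Springs and inerters are called energy storage elements. A network is series-parallel if it is a single element or a series or parallel connection of two smaller series-parallel networks. A real-rational function $Z(s)$ is positive-real if $\Re(Z(s))\ge 0$ for $\Re(s)>0$. For $Z=a/d$ with coprime polynomials $a,d$, the McMillan degree is $\delta(Z)=\max\{\deg a,\deg d\}$; $\delta(Z)=3$ means that numerator and denominator as displayed are coprime with maximum degree $3$. *)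

(* Defs.v *)
From HB Require Import structures.
From mathcomp Require Import all_boot all_order all_algebra.
From mathcomp Require Import complex.
From mathcomp Require Import reals.

Set Implicit Arguments.
Unset Strict Implicit.
Unset Printing Implicit Defensive.

Import Order.TTheory GRing.Theory Num.Theory.
Local Open Scope ring_scope.

(** * Real-rational functions *)

Definition cubic (R : realType) (c3 c2 c1 c0 : R) : {poly R} :=
  c3 *: 'X^3 + c2 *: 'X^2 + c1 *: 'X + c0%:P.

Definition ceval (R : realType) (p : {poly R}) (s : R[i]) : R[i] :=
  (map_poly (real_complex R) p).[s].

(* The inequality is required only where a / d is defined. *)
Definition positive_real (R : realType) (a d : {poly R}) : Prop :=
  forall s : R[i], 0 < complex.Re s -> ceval d s != 0 ->
    0 <= complex.Re (ceval a s / ceval d s).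

(* [size p] is [deg p + 1]; the numerator and denominator as displayed are
   required to be coprime, so this is a property of the fraction a / d. *)
Definition has_mcmillan_degree (R : realType) (a d : {poly R}) (n : nat) :
    Prop :=
  [/\ d != 0, coprimep a d & maxn (size a).-1 (size d).-1 = n].

(* Only meaningful for coprime a and d. *)
Definition is_pole (R : realType) (a d : {poly R}) (s : R[i]) : Prop :=
  ceval d s = 0.
Definition is_zero (R : realType) (a d : {poly R}) (s : R[i]) : Prop :=
  ceval a s = 0.

(** * Networks *)

Inductive element (R : realType) : Type :=
| Damper (c : R) of 0 < c
| Spring (k : R) of 0 < k
| Inerter (b : R) of 0 < b.

Definition is_damper (R : realType) (x : element R) : bool :=
  if x is Damper _ _ then true else false.

Definition is_storage (R : realType) (x : element R) : bool :=
  ~~ is_damper x.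

(* Laplace transforms are taken with zero initial conditions, so that velocities
   and forces become elements of the field R(s) of real-rational functions. *)
Notation rational R := {fraction {poly R}}.

Definition ratfun (R : realType) (p q : {poly R}) : rational R :=
  FracField.tofrac p / FracField.tofrac q.

Definition element_impedance (R : realType) (x : element R) : rational R :=
  match x with
  | Damper c _ => ratfun 1 c%:P
  | Spring k _ => ratfun 'X k%:P
  | Inerter b _ => ratfun 1 (b *: 'X)
  end.

(* Vertices are [inl false] and [inl true], the two (distinct) terminals a and
   a', and [inr i] for an internal vertex i.  Multiple edges are allowed; the
   orientation of an edge is only a reference direction for its force. *)
Definition vertex (I : finType) : finType := (bool + I)%type.

Definition term1 (I : finType) : vertex I := inl false.
Definition term2 (I : finType) : vertex I := inl true.

Record network (R : realType) := Network {
  inode : finType;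
  edge : finType;
  src : edge -> vertex inode;
  tgt : edge -> vertex inode;
  elem : edge -> element R
}.

Definition joins (R : realType) (N : network R) (e : edge N)
    (x y : vertex (inode N)) : bool :=
  ((src e == x) && (tgt e == y)) || ((src e == y) && (tgt e == x)).

Definition adj (R : realType) (N : network R) : rel (vertex (inode N)) :=
  fun x y => [exists e : edge N, joins e x y].

Definition connected_network (R : realType) (N : network R) : Prop :=
  forall x y : vertex (inode N), connect (adj (N := N)) x y.

(* A simple path from a to a' is given by the sequence p of its vertices after
   a; it can be taken to use e iff it visits the ends of e consecutively. *)
Definition on_simple_path (R : realType) (N : network R) (e : edge N) : Prop :=
  exists p : seq (vertex (inode N)),
    [/\ path (adj (N := N)) (term1 _) p,
        last (term1 _) p = term2 _,
        uniq (term1 _ :: p) &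
        exists x y, (x, y) \in zip (term1 _ :: p) p /\ joins e x y].

Definition well_formed (R : realType) (N : network R) : Prop :=
  connected_network N /\ forall e : edge N, on_simple_path e.

(** Driving-point impedance *)

(* v : vertex velocities; f : element forces, counted from src to tgt;
   F : external force entering at a and leaving at a'. *)
Definition behaviour (R : realType) (N : network R)
    (v : vertex (inode N) -> rational R) (f : edge N -> rational R)
    (F : rational R) : Prop :=
  (forall e, v (src e) - v (tgt e) = element_impedance (elem e) * f e) /\
  (forall x, \sum_(e | src e == x) f e - \sum_(e | tgt e == x) f e =
             F *+ (x == term1 _) - F *+ (x == term2 _)).

(* Any external force can be applied, and the relative velocity across the
   terminals is then always Z times that force. *)
Definition has_impedance (R : realType) (N : network R) (Z : rational R) :
    Prop :=
  (forall F, exists v f, behaviour (N := N) v f F) /\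
  (forall v f F, behaviour (N := N) v f F -> v (term1 _) - v (term2 _) = Z * F).

(** Series-parallel networks *)

Definition single_network (R : realType) (x : element R) : network R :=
  @Network R void unit (fun=> term1 _) (fun=> term2 _) (fun=> x).

(* In a series connection the terminal a' of the first network is identified
   with the terminal a of the second; it becomes the internal vertex [None]. *)
Definition series_left (I1 I2 : finType) (x : vertex I1) :
    vertex (option (I1 + I2)%type) :=
  match x with
  | inl false => term1 _
  | inl true => inr None
  | inr i => inr (Some (inl i))
  end.

Definition series_right (I1 I2 : finType) (x : vertex I2) :
    vertex (option (I1 + I2)%type) :=
  match x with
  | inl false => inr None
  | inl true => term2 _
  | inr i => inr (Some (inr i))
  end.

Definition series_connection (R : realType) (N1 N2 : network R) : network R :=
  @Network R (option (inode N1 + inode N2)%type) (edge N1 + edge N2)%type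
    (fun e => match e with
              | inl e1 => series_left (inode N2) (src e1)
              | inr e2 => series_right (inode N1) (src e2) end)
    (fun e => match e with
              | inl e1 => series_left (inode N2) (tgt e1)
              | inr e2 => series_right (inode N1) (tgt e2) end)
    (fun e => match e with inl e1 => elem e1 | inr e2 => elem e2 end).

Definition parallel_left (I1 I2 : finType) (x : vertex I1) :
    vertex (I1 + I2)%type :=
  match x with inl t => inl t | inr i => inr (inl i) end.

Definition parallel_right (I1 I2 : finType) (x : vertex I2) :
    vertex (I1 + I2)%type :=
  match x with inl t => inl t | inr i => inr (inr i) end.

Definition parallel_connection (R : realType) (N1 N2 : network R) : network R :=
  @Network R (inode N1 + inode N2)%type (edge N1 + edge N2)%type
    (fun e => match e with
              | inl e1 => parallel_left (inode N2) (src e1)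
              | inr e2 => parallel_right (inode N1) (src e2) end)
    (fun e => match e with
              | inl e1 => parallel_left (inode N2) (tgt e1)
              | inr e2 => parallel_right (inode N1) (tgt e2) end)
    (fun e => match e with inl e1 => elem e1 | inr e2 => elem e2 end).

(* Not closed under isomorphism or change of reference directions; every
   series-parallel network is equivalent in this sense to one of these. *)
Inductive series_parallel (R : realType) : network R -> Prop :=
| SP_single (x : element R) : series_parallel (single_network x)
| SP_series (N1 N2 : network R) :
    series_parallel N1 -> series_parallel N2 ->
    series_parallel (series_connection N1 N2)
| SP_parallel (N1 N2 : network R) :
    series_parallel N1 -> series_parallel N2 ->
    series_parallel (parallel_connection N1 N2).

Definition num_storage (R : realType) (N : network R) : nat :=
  #|[pred e : edge N | is_storage (elem e)]|.

Definition num_dampers (R : realType) (N : network R) : nat :=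
  #|[pred e : edge N | is_damper (elem e)]|.

(* Main.v *)
Require Import Defs.
From mathcomp Require Import all_boot all_order all_algebra.
From mathcomp Require Import complex polyrcf ring lra.
From mathcomp Require Import reals.
Import Order.TTheory GRing.Theory Num.Theory.
Local Open Scope ring_scope.

(* If d(iw) = 0 with w <> 0, then d = (s^2 + w^2)(d3 s + d2).  Letting s tend to
   iw from the right half-plane, positive-realness forces the residue of Z at iw
   to be a nonnegative real, so that
     Z = b s / (s^2 + w^2) + (a3 s + q) / (d3 s + d2),
   with q = a0 / w^2 and b >= 0; coprimality gives b > 0 and excludes
   a3 d2 = q d3.  The first term is a spring in parallel with an inerter, and the
   second one needs a single energy storage element and at most two dampers.  If
   instead iw is a zero of Z, this applies to 1 / Z, and the dual network
   realizes Z. *)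

(** * Well-formedness of series and parallel connections *)

Section Embedding.

(** [h] and [g] form a graph morphism; the instances used below are the inclusions of two components
    into their series or parallel connection. *)
Context {R : realType} {N M : network R}.
Context (h : vertex (inode N) -> vertex (inode M)) (g : edge N -> edge M).
Hypothesis src_h : forall e, src (g e) = h (src e).
Hypothesis tgt_h : forall e, tgt (g e) = h (tgt e).

Lemma joins_embed e x y : joins e x y -> joins (g e) (h x) (h y).
Proof.
rewrite /joins src_h tgt_h.
by case/orP=> /andP[/eqP-> /eqP->]; rewrite !eqxx ?orbT.
Qed.

Lemma adj_embed : {homo h : x y / adj x y}.
Proof.
by move=> x y /existsP[e exy]; apply/existsP; exists (g e); apply: joins_embed.
Qed.

Lemma connect_embed : {homo h : x y / connect (adj (N := _)) x y}.
Proof.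
move=> x y /connectP[p xp ->]; apply/connectP; exists (map h p).
  exact: homo_path adj_embed xp.
by rewrite last_map.
Qed.

Lemma consecutive_embed e x p :
  (exists x' y', (x', y') \in zip (x :: p) p /\ joins e x' y') ->
  exists x' y', (x', y') \in zip (h x :: map h p) (map h p) /\
                joins (g e) x' y'.
Proof.
move=> [x' [y' [xy exy]]].
exists (h x'), (h y'); split; last exact: joins_embed.
elim: p x xy => [|z p IHp] x //=; rewrite !inE => /orP[/eqP[-> ->]|/IHp->].
  by rewrite eqxx.
by rewrite orbT.
Qed.

End Embedding.

Lemma connect_via {T : finType} (e : rel T) z :
  (forall x, connect e x z /\ connect e z x) -> forall x y, connect e x y.
Proof. by move=> ez x y; apply: connect_trans (ez x).1 (ez y).2. Qed.

Lemma zip_path_cat {T : Type} (x : T) p q :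
  zip (x :: p ++ q) (p ++ q) = zip (x :: p) p ++ zip (last x p :: q) q.
Proof. by elim: p x => //= y p IHp x; rewrite IHp. Qed.

(** An edge of a series connection lies in one component; this supplies a simple crossing of the
    other. *)
Lemma connected_simple_path {R : realType} (N : network R) :
  connected_network N -> exists p,
  [/\ path (adj (N := N)) (term1 _) p, last (term1 _) p = term2 _ &
      uniq (term1 _ :: p)].
Proof.
move=> /(_ (term1 _) (term2 _))/connectP[p tp].
by case/shortenP: tp => q tq uq _ lq; exists q; rewrite lq.
Qed.

Lemma series_left_inj {I1 I2} : injective (@series_left I1 I2).
Proof. by move=> [[]|i] [[]|j] //= [->]. Qed.

Lemma series_right_inj {I1 I2} : injective (@series_right I1 I2).
Proof. by move=> [[]|i] [[]|j] //= [->]. Qed.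

Lemma parallel_left_inj {I1 I2} : injective (@parallel_left I1 I2).
Proof. by move=> [t|i] [u|j] //= [->]. Qed.

Lemma parallel_right_inj {I1 I2} : injective (@parallel_right I1 I2).
Proof. by move=> [t|i] [u|j] //= [->]. Qed.

Lemma well_formed_single {R : realType} (x : element R) :
  well_formed (single_network x).
Proof.
have adj12 : adj (N := single_network x) (term1 _) (term2 _).
  by apply/existsP; exists tt.
have adj21 : adj (N := single_network x) (term2 _) (term1 _).
  by apply/existsP; exists tt.
split=> [|[]].
  by move=> [[]|[]] [[]|[]]; rewrite ?connect0 // connect1.
exists [:: term2 _]; split=> //=; first by rewrite adj12.
by exists (term1 _), (term2 _); rewrite inE /joins /= !eqxx.
Qed.

Section Connections.

Context {R : realType} (N1 N2 : network R).

Let S := series_connection N1 N2.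
Let P := parallel_connection N1 N2.
Let sl : vertex (inode N1) -> vertex (inode S) := @series_left _ _.
Let sr : vertex (inode N2) -> vertex (inode S) := @series_right _ _.
Let pl : vertex (inode N1) -> vertex (inode P) := @parallel_left _ _.
Let pr : vertex (inode N2) -> vertex (inode P) := @parallel_right _ _.
Let el : edge N1 -> edge S := @inl _ _.
Let er : edge N2 -> edge S := @inr _ _.
Let el' : edge N1 -> edge P := @inl _ _.
Let er' : edge N2 -> edge P := @inr _ _.

Let connect_sl := @connect_embed R N1 S sl el (fun=> erefl) (fun=> erefl).
Let connect_sr := @connect_embed R N2 S sr er (fun=> erefl) (fun=> erefl).
Let connect_pl := @connect_embed R N1 P pl el' (fun=> erefl) (fun=> erefl).
Let connect_pr := @connect_embed R N2 P pr er' (fun=> erefl) (fun=> erefl).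
Let adj_sl := @adj_embed R N1 S sl el (fun=> erefl) (fun=> erefl).
Let adj_sr := @adj_embed R N2 S sr er (fun=> erefl) (fun=> erefl).
Let adj_pl := @adj_embed R N1 P pl el' (fun=> erefl) (fun=> erefl).
Let adj_pr := @adj_embed R N2 P pr er' (fun=> erefl) (fun=> erefl).

Lemma connected_series :
  connected_network N1 -> connected_network N2 -> connected_network S.
Proof.
(* The hub is the joining vertex, which is also [sr (term1 _)]. *)
move=> c1 c2; apply: (@connect_via _ _ (sl (term2 _))).
have c1l x : connect (adj (N := S)) (sl x) (sl (term2 _)) /\
  connect (adj (N := S)) (sl (term2 _)) (sl x) by split; apply: connect_sl.
have c2r x : connect (adj (N := S)) (sr x) (sr (term1 _)) /\
  connect (adj (N := S)) (sr (term1 _)) (sr x) by split; apply: connect_sr.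
move=> [[]|[[i|i]|]].
- exact: (c2r (term2 _)).
- exact: (c1l (term1 _)).
- exact: (c1l (inr i)).
- exact: (c2r (inr i)).
- exact: (c1l (term2 _)).
Qed.

Lemma connected_parallel :
  connected_network N1 -> connected_network N2 -> connected_network P.
Proof.
move=> c1 c2; apply: (@connect_via _ _ (pl (term1 _))).
have c1l x : connect (adj (N := P)) (pl x) (pl (term1 _)) /\
  connect (adj (N := P)) (pl (term1 _)) (pl x) by split; apply: connect_pl.
have c2r x : connect (adj (N := P)) (pr x) (pr (term1 _)) /\
  connect (adj (N := P)) (pr (term1 _)) (pr x) by split; apply: connect_pr.
move=> [t|[i|i]].
- exact: (c1l (inl t)).
- exact: (c1l (inr i)).
- exact: (c2r (inr i)).
Qed.

(** A simple path through the given edge in its own component is concatenated with any simple path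
    across the other one. *)
Lemma well_formed_series : well_formed N1 -> well_formed N2 -> well_formed S.
Proof.
move=> [c1 w1] [c2 w2]; split; first exact: connected_series.
pose q (p1 : seq (vertex (inode N1))) (p2 : seq (vertex (inode N2))) :=
  map sl p1 ++ map sr p2.
have simple p1 p2 : path (adj (N := N1)) (term1 _) p1 ->
    last (term1 _) p1 = term2 _ -> uniq (term1 _ :: p1) ->
    path (adj (N := N2)) (term1 _) p2 ->
    last (term1 _) p2 = term2 _ -> uniq (term1 _ :: p2) ->
  [/\ path (adj (N := S)) (term1 _) (q p1 p2),
      last (term1 _) (q p1 p2) = term2 _, uniq (term1 _ :: q p1 p2) &
      forall xy, xy \in zip (term1 _ :: q p1 p2) (q p1 p2) =
        (xy \in zip (sl (term1 _) :: map sl p1) (map sl p1)) ||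
        (xy \in zip (sr (term1 _) :: map sr p2) (map sr p2))].
  move=> t1 l1 u1 t2 l2 u2.
  have lsl : last (term1 _) (map sl p1) = sr (term1 _).
    by rewrite -[term1 _]/(sl (term1 _)) last_map l1.
  split.
  - rewrite cat_path lsl (homo_path adj_sr t2) andbT.
    exact: (homo_path adj_sl t1).
  - by rewrite last_cat lsl last_map l2.
  - rewrite -cat_cons -[term1 _ :: map sl p1]/(map sl (term1 _ :: p1)).
    rewrite cat_uniq (map_inj_uniq series_left_inj) u1 /=.
    move: u2; rewrite cons_uniq => /andP[t2p u2].
    rewrite (map_inj_uniq series_right_inj) u2 andbT.
    apply/hasPn=> _ /mapP[x xp ->]; apply/negP.
    rewrite -[_ \in _]/(sr x \in map sl (term1 _ :: p1)) => /mapP[y _].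
    (* The two images meet only where [sr (term1 _)] equals [sl (term2 _)], and [p2], the tail of a
       simple path, avoids [term1 _]. *)
    case: x xp => [[]|i] xp; case: y => [[]|j] //.
    by move: t2p; rewrite xp.
  - by move=> xy; rewrite zip_path_cat mem_cat lsl.
case=> e.
  have [p1 [t1 l1 u1 e1]] := w1 e.
  have [p2 [t2 l2 u2]] := connected_simple_path _ c2.
  have [tq lq uq zq] := simple _ _ t1 l1 u1 t2 l2 u2.
  exists (q p1 p2); split=> //.
  have := @consecutive_embed R N1 S sl el (fun=> erefl) (fun=> erefl) _ _ _ e1.
  by move=> [x [y [xy j]]]; exists x, y; rewrite zq xy.
have [p2 [t2 l2 u2 e2]] := w2 e.
have [p1 [t1 l1 u1]] := connected_simple_path _ c1.
have [tq lq uq zq] := simple _ _ t1 l1 u1 t2 l2 u2.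
exists (q p1 p2); split=> //.
have := @consecutive_embed R N2 S sr er (fun=> erefl) (fun=> erefl) _ _ _ e2.
by move=> [x [y [xy j]]]; exists x, y; rewrite zq xy orbT.
Qed.

Lemma well_formed_parallel : well_formed N1 -> well_formed N2 -> well_formed P.
Proof.
move=> [c1 w1] [c2 w2]; split; first exact: connected_parallel.
case=> e.
  have [p [t l u ep]] := w1 e; exists (map pl p); split.
  - exact: (homo_path adj_pl t).
  - by rewrite -[term1 _]/(pl (term1 _)) last_map l.
  - rewrite -[_ :: _]/(map pl (term1 _ :: p)).
    by rewrite (map_inj_uniq parallel_left_inj).
  - exact (@consecutive_embed R N1 P pl el' (fun=> erefl) (fun=> erefl)
             _ _ _ ep).
have [p [t l u ep]] := w2 e; exists (map pr p); split.
- exact: (homo_path adj_pr t).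
- by rewrite -[term1 _]/(pr (term1 _)) last_map l.
- rewrite -[_ :: _]/(map pr (term1 _ :: p)).
  by rewrite (map_inj_uniq parallel_right_inj).
- exact (@consecutive_embed R N2 P pr er' (fun=> erefl) (fun=> erefl) _ _ _ ep).
Qed.

Lemma num_storage_series : num_storage S = (num_storage N1 + num_storage N2)%N.
Proof. by rewrite /num_storage -!sum1_card big_sumType. Qed.

Lemma num_dampers_series : num_dampers S = (num_dampers N1 + num_dampers N2)%N.
Proof. by rewrite /num_dampers -!sum1_card big_sumType. Qed.

Lemma num_storage_parallel :
  num_storage P = (num_storage N1 + num_storage N2)%N.
Proof. by rewrite /num_storage -!sum1_card big_sumType. Qed.

Lemma num_dampers_parallel :
  num_dampers P = (num_dampers N1 + num_dampers N2)%N.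
Proof. by rewrite /num_dampers -!sum1_card big_sumType. Qed.

End Connections.

(** * Impedances of series and parallel connections *)

Section Netflow.

Context {K : zmodType}.

(** Net force leaving [z]. The end maps are parameters so that the flow in a connection splits into
    flows along the end maps of its components. *)
Definition netflow {V : eqType} {E : finType} (s t : E -> V) (f : E -> K) z :=
  \sum_(e | s e == z) f e - \sum_(e | t e == z) f e.

(** Every edge contributes [f e] once at its source and [- f e] once at its target. *)
Lemma netflow_total {V E : finType} (s t : E -> V) (f : E -> K) :
  \sum_z netflow s t f z = 0.
Proof.
have sum_fibres (u : E -> V) : \sum_z \sum_(e | u e == z) f e = \sum_e f e.
  by rewrite (partition_big u xpredT).
by rewrite /netflow sumrB !sum_fibres subrr.
Qed.

Lemma netflow_sum {V : eqType} {E1 E2 : finType} (s t : E1 + E2 -> V) f z :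
  netflow s t f z = netflow (s \o inl) (t \o inl) (f \o inl) z +
                    netflow (s \o inr) (t \o inr) (f \o inr) z.
Proof. by rewrite /netflow !big_sumType /= opprD addrACA. Qed.

Lemma netflow_inj {V W : eqType} {E : finType} (h : V -> W) (s t : E -> V) f z :
  injective h -> netflow (h \o s) (h \o t) f (h z) = netflow s t f z.
Proof.
by move=> h_inj; congr (_ - _); apply: eq_bigl => e; rewrite /= inj_eq.
Qed.

Lemma netflow_out {V W : eqType} {E : finType} (h : V -> W) (s t : E -> V) f z :
  (forall x, h x != z) -> netflow (h \o s) (h \o t) f z = 0.
Proof.
move=> hz; rewrite /netflow !big_pred0 ?subrr // => e; exact/negbTE/hz.
Qed.

Lemma netflow_term2 {I E : finType} (s t : E -> vertex I) f :
  (forall i, netflow s t f (inr i) = 0) ->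
  netflow s t f (term2 I) = - netflow s t f (term1 I).
Proof.
move=> f0; have := netflow_total s t f.
rewrite big_sumType /= [X in _ + X]big1 ?addr0 => [|i _]; last exact: f0.
by rewrite big_bool /= => /eqP; rewrite addr_eq0 => /eqP.
Qed.

End Netflow.

(** The balance at a' comes from conservation, once it holds at a and at the internal vertices. *)
Lemma behaviourP {R : realType} (N : network R) v f F :
  behaviour (N := N) v f F <->
  [/\ forall e, v (src e) - v (tgt e) = element_impedance (elem e) * f e,
      netflow (@src R N) (@tgt R N) f (term1 _) = F &
      forall i, netflow (@src R N) (@tgt R N) f (inr i) = 0].
Proof.
split=> [[ohm kcl]|[ohm f1 f0]].
  split=> [//||i]; first by rewrite /netflow kcl /= subr0.
  by rewrite /netflow kcl /= subr0.
split=> // -[[]|i]; rewrite -/(netflow (@src R N) (@tgt R N) f _) /=.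
- by rewrite (netflow_term2 _ _ _ f0) f1 sub0r.
- by rewrite f1 subr0.
- by rewrite f0 subr0.
Qed.

(** Only velocity differences matter. The shift serves to match the velocities of two components
    when they are glued. *)
Lemma behaviour_shift {R : realType} (N : network R) v f F c :
  behaviour (N := N) v f F -> behaviour (N := N) (fun x => v x + c) f F.
Proof.
by move=> [ohm kcl]; split=> // e; rewrite -ohm opprD addrACA subrr addr0.
Qed.

Section CurrentDivider.

Context {K : fieldType} (a b : K).
Hypotheses (a0 : a != 0) (b0 : b != 0) (ab0 : a + b != 0).

(** Branches of impedances [a] and [b] carry shares of [F] proportional to the opposite impedance,
    which equalizes their velocity drops. *)
Lemma current_divider_sum F : F = b / (a + b) * F + a / (a + b) * F.
Proof. by field. Qed.

Lemma current_divider_drop F : a * (b / (a + b) * F) = b * (a / (a + b) * F).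
Proof. by field. Qed.

Lemma parallel_total_force F1 F2 :
  b * F2 = a * F1 -> b * F2 = (a^-1 + b^-1)^-1 * (F1 + F2).
Proof.
move=> e; have -> : F1 = b * F2 / a by rewrite e mulrAC mulfV // mul1r.
by field; rewrite a0 b0 addrC ab0.
Qed.

End CurrentDivider.

Section ConnectionImpedance.

Context {R : realType} (N1 N2 : network R).

Let S := series_connection N1 N2.
Let P := parallel_connection N1 N2.

(** Away from the joining vertex, no edge of [N2] touches the image of [N1]. *)
Lemma netflow_series_left (f : edge S -> Defs.rational R) x : x != term2 _ ->
  netflow (@src R S) (@tgt R S) f (series_left (inode N2) x) =
  netflow (@src R N1) (@tgt R N1) (f \o inl) x.
Proof.
move=> x2; rewrite netflow_sum.
rewrite [X in X + _](netflow_inj (@series_left (inode N1) (inode N2)));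
  last first.
  exact: series_left_inj.
rewrite [X in _ + X](netflow_out (@series_right (inode N1) (inode N2)))
  ?addr0 // => y.
by case: x x2 => [[]|i]; case: y => [[]|j].
Qed.

Lemma netflow_series_right (f : edge S -> Defs.rational R) x : x != term1 _ ->
  netflow (@src R S) (@tgt R S) f (series_right (inode N1) x) =
  netflow (@src R N2) (@tgt R N2) (f \o inr) x.
Proof.
move=> x1; rewrite netflow_sum.
rewrite [X in _ + X](netflow_inj (@series_right (inode N1) (inode N2)));
  last first.
  exact: series_right_inj.
rewrite [X in X + _](netflow_out (@series_left (inode N1) (inode N2)))
  ?add0r // => y.
by case: x x1 => [[]|i]; case: y => [[]|j].
Qed.

Lemma netflow_series_mid (f : edge S -> Defs.rational R) :
  netflow (@src R S) (@tgt R S) f (inr None) =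
  netflow (@src R N1) (@tgt R N1) (f \o inl) (term2 _) +
  netflow (@src R N2) (@tgt R N2) (f \o inr) (term1 _).
Proof.
rewrite netflow_sum; congr (_ + _).
  exact: (netflow_inj (@series_left (inode N1) (inode N2)) _ _ _ (term2 _)
          series_left_inj).
exact: (netflow_inj (@series_right (inode N1) (inode N2)) _ _ _ (term1 _)
          series_right_inj).
Qed.

Lemma behaviour_series v f F : behaviour (N := S) v f F <->
  behaviour (N := N1) (v \o @series_left _ _) (f \o inl) F /\
  behaviour (N := N2) (v \o @series_right _ _) (f \o inr) F.
Proof.
split.
  move=> /behaviourP[ohm f1 f0].
  have f01 i : netflow (@src R N1) (@tgt R N1) (f \o inl) (inr i) = 0.
    by rewrite -netflow_series_left // (f0 (Some (inl i))).
  have f02 i : netflow (@src R N2) (@tgt R N2) (f \o inr) (inr i) = 0.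
    by rewrite -netflow_series_right // (f0 (Some (inr i))).
  have f1l : netflow (@src R N1) (@tgt R N1) (f \o inl) (term1 _) = F.
    by rewrite -f1 -(netflow_series_left _ (term1 _)).
  split; apply/behaviourP; split=> //.
  - by move=> e; exact: (ohm (inl e)).
  - by move=> e; exact: (ohm (inr e)).
  (* Balance at the joining vertex: the force leaving [N1] enters [N2] unchanged. *)
  - have := f0 None; rewrite netflow_series_mid (netflow_term2 _ _ _ f01) f1l.
    by move/eqP; rewrite addrC subr_eq0 => /eqP.
move=> [/behaviourP[ohm1 f11 f01] /behaviourP[ohm2 f12 f02]].
apply/behaviourP; split.
- by case=> e; [apply: ohm1 | apply: ohm2].
- by rewrite -f11 -netflow_series_left.
- case=> [[i|i]|]; last first.
  + by rewrite netflow_series_mid (netflow_term2 _ _ _ f01) f11 f12 addNr.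
  + by rewrite (netflow_series_right _ (inr i)).
  + by rewrite (netflow_series_left _ (inr i)).
Qed.

Lemma netflow_parallel_left (f : edge P -> Defs.rational R) i :
  netflow (@src R P) (@tgt R P) f (inr (inl i)) =
  netflow (@src R N1) (@tgt R N1) (f \o inl) (inr i).
Proof.
rewrite netflow_sum.
rewrite [X in _ + X](netflow_out (@parallel_right (inode N1) (inode N2))).
  rewrite addr0.
  exact: (netflow_inj (@parallel_left (inode N1) (inode N2)) _ _ _ (inr i)
            parallel_left_inj).
by case.
Qed.

Lemma netflow_parallel_right (f : edge P -> Defs.rational R) i :
  netflow (@src R P) (@tgt R P) f (inr (inr i)) =
  netflow (@src R N2) (@tgt R N2) (f \o inr) (inr i).
Proof.
rewrite netflow_sum.
rewrite [X in X + _](netflow_out (@parallel_left (inode N1) (inode N2))).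
  rewrite add0r.
  exact: (netflow_inj (@parallel_right (inode N1) (inode N2)) _ _ _ (inr i)
            parallel_right_inj).
by case.
Qed.

Lemma netflow_parallel_term (f : edge P -> Defs.rational R) t :
  netflow (@src R P) (@tgt R P) f (inl t) =
  netflow (@src R N1) (@tgt R N1) (f \o inl) (inl t) +
  netflow (@src R N2) (@tgt R N2) (f \o inr) (inl t).
Proof.
rewrite netflow_sum; congr (_ + _).
  exact: (netflow_inj (@parallel_left (inode N1) (inode N2)) _ _ _ (inl t)
            parallel_left_inj).
exact: (netflow_inj (@parallel_right (inode N1) (inode N2)) _ _ _ (inl t)
          parallel_right_inj).
Qed.

Lemma behaviour_parallel v f F : behaviour (N := P) v f F <->
  exists F1 F2,
  [/\ F = F1 + F2,
      behaviour (N := N1) (v \o @parallel_left _ _) (f \o inl) F1 &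
      behaviour (N := N2) (v \o @parallel_right _ _) (f \o inr) F2].
Proof.
split.
  move=> /behaviourP[ohm f1 f0]; rewrite netflow_parallel_term in f1.
  (* Unification takes [F1] and [F2] to be the net flows of the two components at a. *)
  rewrite -f1; do 2!eexists; split; first reflexivity.
    apply/behaviourP; split=> // [e|i]; first exact: (ohm (inl e)).
    by rewrite -netflow_parallel_left (f0 (inl i)).
  apply/behaviourP; split=> // [e|i]; first exact: (ohm (inr e)).
  by rewrite -netflow_parallel_right (f0 (inr i)).
move=> [F1 [F2 [-> /behaviourP[ohm1 f11 f01] /behaviourP[ohm2 f12 f02]]]].
apply/behaviourP; split.
- by case=> e; [apply: ohm1 | apply: ohm2].
- by rewrite netflow_parallel_term f11 f12.
- by case=> i; rewrite ?netflow_parallel_left ?netflow_parallel_right.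
Qed.

Lemma has_impedance_series Z1 Z2 :
  has_impedance N1 Z1 -> has_impedance N2 Z2 -> has_impedance S (Z1 + Z2).
Proof.
move=> [ex1 imp1] [ex2 imp2]; split=> [F|v f F /behaviour_series[b1 b2]].
  have [v1 [f1 b1]] := ex1 F; have [v2 [f2 b2]] := ex2 F.
  (* Shifting [v2] by [c] makes the two velocities agree at the joining vertex. *)
  pose c := v1 (term2 _) - v2 (term1 _).
  pose v (x : vertex (inode S)) := match x with
    | inl false => v1 (term1 _) | inl true => v2 (term2 _) + c
    | inr None => v1 (term2 _) | inr (Some (inl i)) => v1 (inr i)
    | inr (Some (inr i)) => v2 (inr i) + c end.
  exists v, (fun e => match e with inl e => f1 e | inr e => f2 e end).
  apply/behaviour_series; split.
    have v1E x : v (series_left (inode N2) x) = v1 x by case: x => [[]|i].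
    case: b1 => ohm kcl.
    by split=> [e|x]; [rewrite /= !v1E ohm | rewrite -kcl].
  have v2E x : v (series_right (inode N1) x) = v2 x + c.
    by case: x => [[]|i] //=; rewrite /c addrC subrK.
  case: (behaviour_shift _ _ _ _ c b2) => ohm kcl.
  by split=> [e|x]; [rewrite /= !v2E ohm | rewrite -kcl].
have /= := imp1 _ _ _ b1; have /= := imp2 _ _ _ b2.
by rewrite mulrDl => <- <-; rewrite addrA subrK.
Qed.

Lemma has_impedance_parallel Z1 Z2 :
  Z1 != 0 -> Z2 != 0 -> Z1 + Z2 != 0 ->
  has_impedance N1 Z1 -> has_impedance N2 Z2 ->
  has_impedance P (Z1^-1 + Z2^-1)^-1.
Proof.
move=> Z1n Z2n Z12n [ex1 imp1] [ex2 imp2]; split=> [F|v f F].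
  have [v1 [f1 b1]] := ex1 (Z2 / (Z1 + Z2) * F).
  have [v2 [f2 b2]] := ex2 (Z1 / (Z1 + Z2) * F).
  (* Shifting [v2] by [c] makes the two velocities agree at a. *)
  pose c := v1 (term1 _) - v2 (term1 _).
  pose v (x : vertex (inode P)) := match x with
    | inl t => v1 (inl t)
    | inr (inl i) => v1 (inr i) | inr (inr i) => v2 (inr i) + c end.
  exists v, (fun e => match e with inl e => f1 e | inr e => f2 e end).
  apply/behaviour_parallel.
  exists (Z2 / (Z1 + Z2) * F), (Z1 / (Z1 + Z2) * F); split.
  - exact: current_divider_sum.
  - have v1E x : v (parallel_left (inode N2) x) = v1 x by case: x => [t|i].
    case: b1 => ohm kcl.
    by split=> [e|x]; [rewrite /= !v1E ohm | rewrite -kcl].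
  - have v2E x : v (parallel_right (inode N1) x) = v2 x + c.
      case: x => [[]|i] //=; last by rewrite /c addrC subrK.
      (* Agreement at a' then follows, since the divided forces produce equal drops. *)
      have drop : v1 (term1 _) - v1 (term2 _) = v2 (term1 _) - v2 (term2 _).
        rewrite (imp1 _ _ _ b1) (imp2 _ _ _ b2).
        exact: current_divider_drop.
      rewrite /c -[v1 (inl true)](subKr (v1 (term1 _))) drop opprB addrCA.
      by rewrite addrC.
    case: (behaviour_shift _ _ _ _ c b2) => ohm kcl.
    by split=> [e|x]; [rewrite /= !v2E ohm | rewrite -kcl].
move=> /behaviour_parallel[F1 [F2 [-> b1 b2]]].
have e1 : v (term1 _) - v (term2 _) = Z1 * F1 := imp1 _ _ _ b1.
have e2 : v (term1 _) - v (term2 _) = Z2 * F2 := imp2 _ _ _ b2.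
rewrite e2; apply: (parallel_total_force _ _ Z1n Z2n Z12n).
by rewrite -e1 -e2.
Qed.

End ConnectionImpedance.

Lemma has_impedance_single {R : realType} (x : element R) :
  has_impedance (single_network x) (element_impedance x).
Proof.
split=> [F|v f F /behaviourP[ohm <- _]].
  exists (fun z => (element_impedance x * F) *+ (z == term1 _)), (fun=> F).
  apply/behaviourP; split=> [[]||[]] /=; first by rewrite subr0.
  rewrite /netflow /= [X in _ - X]big_pred0 // subr0.
  by rewrite (big_pred1 tt) // => -[].
rewrite (ohm tt) /netflow /=; congr (_ * _).
by rewrite [X in _ - X]big_pred0 // subr0 (big_pred1 tt) // => -[].
Qed.

(** * Series-parallel impedances and duality *)

(** Indexed by the numbers of storage elements and dampers. Forgetting the graph makes duality a
    plain induction on impedances. *)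
Inductive sp_impedance {R : realType} : Defs.rational R -> nat -> nat -> Prop :=
| SPI_element (x : element R) :
    sp_impedance (element_impedance x) (is_storage x) (is_damper x)
| SPI_series Z1 Z2 m1 m2 n1 n2 :
    sp_impedance Z1 m1 n1 -> sp_impedance Z2 m2 n2 ->
    sp_impedance (Z1 + Z2) (m1 + m2) (n1 + n2)
| SPI_parallel Z1 Z2 m1 m2 n1 n2 :
    sp_impedance Z1 m1 n1 -> sp_impedance Z2 m2 n2 ->
    sp_impedance (Z1^-1 + Z2^-1)^-1 (m1 + m2) (n1 + n2).

Arguments SPI_series {R Z1 Z2 m1 m2 n1 n2}.
Arguments SPI_parallel {R Z1 Z2 m1 m2 n1 n2}.

(* Positivity at s = 1 is inherited by sums and inverses, so the impedances met
   in a parallel connection never cancel. *)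
Definition positive_at1 {R : realType} (Z : Defs.rational R) : Prop :=
  exists p q : {poly R}, [/\ Z = ratfun p q, 0 < p.[1] & 0 < q.[1]].

Section PositiveAt1.

Context {R : realType}.
Implicit Types (p q : {poly R}) (Z : Defs.rational R).

Lemma tofrac_neq0 p : p.[1] != 0 -> FracField.tofrac p != 0.
Proof. by rewrite tofrac_eq0; apply: contraNneq => ->; rewrite horner0. Qed.

Lemma positive_at1_neq0 Z : positive_at1 Z -> Z != 0.
Proof.
move=> [p [q [-> p1 q1]]].
by rewrite mulf_neq0 ?invr_eq0 // tofrac_neq0 // lt0r_neq0.
Qed.

Lemma ratfunV p q : (ratfun p q)^-1 = ratfun q p.
Proof. by rewrite /ratfun invf_div. Qed.

Lemma positive_at1V Z : positive_at1 Z -> positive_at1 Z^-1.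
Proof. by move=> [p [q [-> p1 q1]]]; exists q, p; rewrite ratfunV. Qed.

Lemma positive_at1D Z1 Z2 :
  positive_at1 Z1 -> positive_at1 Z2 -> positive_at1 (Z1 + Z2).
Proof.
move=> [p1 [q1 [-> p1p q1p]]] [p2 [q2 [-> p2p q2p]]].
exists (p1 * q2 + p2 * q1), (q1 * q2); split; last by rewrite hornerM mulr_gt0.
  rewrite /ratfun addf_div ?tofrac_neq0 ?lt0r_neq0 //.
  by rewrite tofracD !tofracM.
by rewrite hornerD !hornerM addr_gt0 // mulr_gt0.
Qed.

Lemma positive_at1_element (x : element R) : positive_at1 (element_impedance x).
Proof.
case: x => c c0; [exists 1, c%:P|exists 'X, c%:P|exists 1, (c *: 'X)];
  by split; rewrite ?hornerZ ?hornerC ?hornerX ?mulr1.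
Qed.

Lemma sp_impedance_positive_at1 Z m n : sp_impedance Z m n -> positive_at1 Z.
Proof.
elim=> [x|Z1 Z2 m1 m2 n1 n2 _ p1 _ p2|Z1 Z2 m1 m2 n1 n2 _ p1 _ p2].
- exact: positive_at1_element.
- exact: positive_at1D.
- by apply/positive_at1V/positive_at1D; exact: positive_at1V.
Qed.

End PositiveAt1.

(** Returns from impedances to networks by induction; positivity at 1 provides the non-vanishing
    conditions of parallel connections. *)
Lemma sp_impedance_realizable {R : realType} (Z : Defs.rational R) m n :
  sp_impedance Z m n ->
  exists N : network R,
    [/\ well_formed N, series_parallel N, has_impedance N Z,
        num_storage N = m & num_dampers N = n].
Proof.
elim=> {Z m n} [x
  |Z1 Z2 m1 m2 n1 n2 _ [N1 [w1 s1 i1 <- <-]] _ [N2 [w2 s2 i2 <- <-]]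
  |Z1 Z2 m1 m2 n1 n2 z1 [N1 [w1 s1 i1 <- <-]] z2 [N2 [w2 s2 i2 <- <-]]].
- exists (single_network x); split.
  + exact: well_formed_single.
  + exact: SP_single.
  + exact: has_impedance_single.
  + rewrite /num_storage -sum1_card big_mkcond /= (big_pred1 tt); last by case.
    by rewrite inE /=; case: is_storage.
  + rewrite /num_dampers -sum1_card big_mkcond /= (big_pred1 tt); last by case.
    by rewrite inE /=; case: is_damper.
- exists (series_connection N1 N2); split.
  + exact: well_formed_series.
  + exact: SP_series.
  + exact: has_impedance_series.
  + exact: num_storage_series.
  + exact: num_dampers_series.
- have p1 := sp_impedance_positive_at1 _ _ _ z1.
  have p2 := sp_impedance_positive_at1 _ _ _ z2.
  exists (parallel_connection N1 N2); split.
  + exact: well_formed_parallel.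
  + exact: SP_parallel.
  + by apply: has_impedance_parallel => //; apply: positive_at1_neq0 => //;
      exact: positive_at1D.
  + exact: num_storage_parallel.
  + exact: num_dampers_parallel.
Qed.

Section ElementImpedances.

Context {R : realType}.

Lemma ratfun_eq (p q p' q' : {poly R}) :
  q != 0 -> q' != 0 -> p * q' = p' * q -> ratfun p q = ratfun p' q'.
Proof.
move=> q0 q'0 e; apply/eqP; rewrite eqr_div ?tofrac_eq0 //.
by rewrite -!tofracM e.
Qed.

(** This and the next two impedances are the inverses of those of a damper, an inerter and a spring;
    they start the induction for duality. *)
Lemma sp_impedance_damper (c : R) : 0 < c -> sp_impedance (ratfun c%:P 1) 0 1.
Proof.
move=> c0; have ci0 : 0 < c^-1 by rewrite invr_gt0.
rewrite (ratfun_eq _ _ 1 c^-1%:P) ?oner_eq0 ?polyC_eq0 ?lt0r_neq0 //.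
  exact: (SPI_element (Damper ci0)).
by rewrite -polyCM mulfV ?mulr1 // lt0r_neq0.
Qed.

Lemma sp_impedance_spring (c : R) :
  0 < c -> sp_impedance (ratfun (c *: 'X) 1) 1 0.
Proof.
move=> c0; have ci0 : 0 < c^-1 by rewrite invr_gt0.
rewrite (ratfun_eq _ _ 'X c^-1%:P) ?oner_eq0 ?polyC_eq0 ?lt0r_neq0 //.
  exact: (SPI_element (Spring ci0)).
by rewrite mulr1 mulrC mul_polyC scalerA mulVf ?scale1r // lt0r_neq0.
Qed.

Lemma sp_impedance_inerter (c : R) :
  0 < c -> sp_impedance (ratfun c%:P 'X) 1 0.
Proof.
move=> c0; have ci0 : 0 < c^-1 by rewrite invr_gt0.
rewrite (ratfun_eq _ _ 1 (c^-1 *: 'X))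
  ?scaler_eq0 ?polyX_eq0 ?orbF ?lt0r_neq0 //.
  exact: (SPI_element (Inerter ci0)).
by rewrite mul_polyC scalerA mulfV ?scale1r ?mul1r // lt0r_neq0.
Qed.

(* Duality: interchange series with parallel connections and springs with
   inerters. *)
Lemma sp_impedanceV (Z : Defs.rational R) m n :
  sp_impedance Z m n -> sp_impedance Z^-1 m n.
Proof.
elim=> [[c c0|c c0|c c0]|Z1 Z2 m1 m2 n1 n2 _ p1 _ p2
       |Z1 Z2 m1 m2 n1 n2 _ p1 _ p2] /=; rewrite ?ratfunV.
- exact: sp_impedance_damper.
- exact: sp_impedance_inerter.
- exact: sp_impedance_spring.
- by rewrite -{1}[Z1]invrK -{1}[Z2]invrK; exact: SPI_parallel.
- by rewrite invrK; exact: SPI_series.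
Qed.

End ElementImpedances.

(** * The principal part at a pole on the imaginary axis *)

(** Real part of the cubic at x + iy. The general ring allows [x] and [y] to be polynomials in a
    perturbation parameter. *)
Definition cubic_re {R : pzRingType} (c3 c2 c1 c0 x y : R) : R :=
  c3 * (x ^+ 3 - x * y ^+ 2 *+ 3) + c2 * (x ^+ 2 - y ^+ 2) + c1 * x + c0.

Definition cubic_im {R : pzRingType} (c3 c2 c1 x y : R) : R :=
  c3 * (x ^+ 2 * y *+ 3 - y ^+ 3) + c2 * (x * y *+ 2) + c1 * y.

Lemma ceval_cubic {R : realType} (c3 c2 c1 c0 x y : R) :
  ceval (cubic c3 c2 c1 c0) (Complex x y) =
  Complex (cubic_re c3 c2 c1 c0 x y) (cubic_im c3 c2 c1 x y).
Proof.
rewrite /ceval /cubic !rmorphD /= !map_polyZ /= !map_polyXn map_polyX map_polyC.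
rewrite !hornerE /= /real_complex_def.
rewrite /cubic_re /cubic_im; simpc; congr Complex; ring.
Qed.

(** Re (a / d) is Re (a conj d) / |d|^2, and the numerator is a real polynomial in x and y. Where d
    vanishes, so does that numerator. *)
Lemma ceval_cubic_ge0 {R : realType} (a3 a2 a1 a0 d3 d2 d1 d0 x y : R) :
  positive_real (cubic a3 a2 a1 a0) (cubic d3 d2 d1 d0) -> 0 < x ->
  0 <= cubic_re a3 a2 a1 a0 x y * cubic_re d3 d2 d1 d0 x y +
       cubic_im a3 a2 a1 x y * cubic_im d3 d2 d1 x y.
Proof.
move=> pr x0; have := pr (Complex x y) x0; rewrite !ceval_cubic.
set u := cubic_re a3 _ _ _ _ _; set v := cubic_im a3 _ _ _ _.
set u' := cubic_re d3 _ _ _ _ _; set v' := cubic_im d3 _ _ _ _.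
have [[-> ->] _|nz /(_ isT)] := eqVneq (Complex u' v') 0.
  by rewrite !mulr0 addr0.
have n0 : 0 < u' ^+ 2 + v' ^+ 2.
  rewrite lt_def addr_ge0 ?sqr_ge0 // andbT paddr_eq0 ?sqr_ge0 //.
  by move: nz; rewrite !sqrf_eq0 eq_complex.
have -> : complex.Re (Complex u v / Complex u' v') =
          (u * u' + v * v') / (u' ^+ 2 + v' ^+ 2).
  by simpc; rewrite /=; field; rewrite lt0r_neq0.
by rewrite pmulr_lge0 // invr_gt0.
Qed.

(** By continuity, a negative value at 0 would persist at some [e / 2 > 0]. *)
Lemma horner0_ge0 {R : rcfType} (p : {poly R}) :
  (forall e, 0 < e -> 0 <= p.[e]) -> 0 <= p.[0].
Proof.
move=> p_ge0; rewrite leNgt; apply/negP => p0.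
have [e e0 /(_ (e / 2))] :=
  @poly_cont _ 0 p (- p.[0]) ltac:(by rewrite oppr_gt0).
rewrite subr0 gtr0_norm ?divr_gt0 // => /(_ _)/ltr_normlW.
have := p_ge0 (e / 2) ltac:(by rewrite divr_gt0) => pe h.
have : p.[e / 2] - p.[0] < - p.[0] by apply: h; lra.
lra.
Qed.

(** With A + iwB = a(iw), one has (A + iwB) conj (d2 + iw d3) = D + iwC for the two displayed
    quantities C and D. The residue at iw is a positive multiple of C - iD/w. *)
Lemma residue_condition {R : realType} (a3 a2 a1 a0 d3 d2 w : R) :
  w != 0 ->
  positive_real (cubic a3 a2 a1 a0) (cubic d3 d2 (w ^+ 2 * d3) (w ^+ 2 * d2)) ->
  0 <= d2 * (a1 - w ^+ 2 * a3) - d3 * (a0 - w ^+ 2 * a2) /\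
  d2 * (a0 - w ^+ 2 * a2) + w ^+ 2 * (d3 * (a1 - w ^+ 2 * a3)) = 0.
Proof.
move=> w0 pr.
set A := a0 - _; set B := a1 - _.
(* Approaching iw in the direction 1 + iy gives the sign of the residue times 1 - iy, for every
   slope [y]. *)
have key y : 0 <= (w ^+ 2 * (d2 * B - d3 * A)
                   - y * (w * (d2 * A + w ^+ 2 * (d3 * B)))) *+ 2.
  (* [p.[e]] is [Re (a (s) conj (d (s))) / e] at [s = iw + e (1 + iy)]. *)
  pose x' : {poly R} := 'X.
  pose y' : {poly R} := w%:P + y *: 'X.
  (* [re] and [im] are the real and imaginary parts of (s^2 + w^2) / e; the division by e leaves
     polynomials that can be evaluated at e = 0. *)
  pose re : {poly R} := 'X * (1 - (y ^+ 2)%:P) - (2 * w * y)%:P.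
  pose im : {poly R} := 2 *: y'.
  pose p := cubic_re a3%:P a2%:P a1%:P a0%:P x' y' *
       (re * (d3 *: x' + d2%:P) - im * (d3 *: y')) +
    cubic_im a3%:P a2%:P a1%:P x' y' *
       (re * (d3 *: y') + im * (d3 *: x' + d2%:P)).
  have pE e : p.[e] =
      cubic_re a3 a2 a1 a0 e (w + y * e) *
        ((e * (1 - y ^+ 2) - 2 * w * y) * (d3 * e + d2)
         - 2 * (w + y * e) * (d3 * (w + y * e))) +
      cubic_im a3 a2 a1 e (w + y * e) *
        ((e * (1 - y ^+ 2) - 2 * w * y) * (d3 * (w + y * e))
         + 2 * (w + y * e) * (d3 * e + d2)).
    rewrite /p /re /im /y' /x' /cubic_re /cubic_im 
      !(hornerD, hornerN, hornerM, hornerZ, hornerC, hornerX,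
        horner_exp, hornerMn).
    by ring.
  have : 0 <= p.[0].
    apply: horner0_ge0 => e e0; rewrite -(pmulr_rge0 _ e0).
    have := ceval_cubic_ge0 _ _ _ _ _ _ _ _ e (w + y * e) pr e0.
    congr (0 <= _); rewrite pE /cubic_re /cubic_im; ring.
  congr (0 <= _); rewrite pE /cubic_re /cubic_im /A /B; ring.
have w2 : 0 < w ^+ 2 by rewrite exprn_even_gt0.
set C := d2 * B - d3 * A in key *; set D := d2 * A + _ in key *.
split.
  by have := key 0; rewrite mul0r subr0 pmulrn_lge0 // pmulr_rge0.
apply/eqP/negPn/negP => D0.
(* This slope makes the quantity in [key] equal to -2. *)
have := key ((w ^+ 2 * C + 1) / (w * D)); rewrite mulfVK ?mulf_neq0 //.
by rewrite opprD addrA subrr sub0r pmulrn_lge0 // oppr_ge0 ler10.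
Qed.

(** * Realization *)

Section Realization.

Context {R : realType}.
Implicit Types (p q : {poly R}).

Lemma ratfunD p q p' q' : q != 0 -> q' != 0 ->
  ratfun p q + ratfun p' q' = ratfun (p * q' + p' * q) (q * q').
Proof.
move=> q0 q'0.
by rewrite /ratfun addf_div ?tofrac_eq0 // tofracD !tofracM.
Qed.

Lemma linear_neq0 (r t : R) : 0 < r -> r *: 'X + t%:P != 0.
Proof.
move=> r0; apply/eqP => /(congr1 (fun s : {poly R} => s`_1)).
rewrite coefD coefZ coefX coefC coef0 mulr1 addr0 => r_eq0.
by rewrite r_eq0 ltxx in r0.
Qed.

Lemma sp_impedance_ratfunC (c d : R) :
  0 < c -> 0 < d -> sp_impedance (ratfun c%:P d%:P) 0 1.
Proof.
move=> c0 d0.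
rewrite (ratfun_eq _ _ (c / d)%:P 1) ?oner_eq0 ?polyC_eq0 ?lt0r_neq0 //.
  by apply: sp_impedance_damper; rewrite divr_gt0.
by rewrite mulr1 -polyCM divfK ?lt0r_neq0.
Qed.

Lemma sp_impedance_ratfunXC (c d : R) :
  0 < c -> 0 < d -> sp_impedance (ratfun (c *: 'X) d%:P) 1 0.
Proof.
move=> c0 d0.
rewrite (ratfun_eq _ _ ((c / d) *: 'X) 1) ?oner_eq0 ?polyC_eq0 ?lt0r_neq0 //.
  by apply: sp_impedance_spring; rewrite divr_gt0.
by rewrite mulr1 mulrC mul_polyC scalerA mulrC divfK ?lt0r_neq0.
Qed.

Lemma sp_impedance_ratfunCX (c d : R) :
  0 < c -> 0 < d -> sp_impedance (ratfun c%:P (d *: 'X)) 1 0.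
Proof.
by move=> c0 d0; rewrite -ratfunV; apply/sp_impedanceV/sp_impedance_ratfunXC.
Qed.

Lemma ratfun_parallel p q p' q' :
    p != 0 -> p' != 0 ->
  ((ratfun p q)^-1 + (ratfun p' q')^-1)^-1 = ratfun (p * p') (q * p' + q' * p).
Proof. by move=> p0 p'0; rewrite !ratfunV ratfunD // ratfunV. Qed.

Lemma sp_impedance_ratfun_eq p q p' q' m n :
    sp_impedance (ratfun p q) m n -> q != 0 -> q' != 0 -> p * q' = p' * q ->
  sp_impedance (ratfun p' q') m n.
Proof. by move=> spZ q0 q'0 /(ratfun_eq _ _ _ _ q0 q'0) <-. Qed.

Lemma scaleX_neq0 (c : R) : 0 < c -> c *: 'X != 0 :> {poly R}.
Proof. by move=> c0; rewrite scaler_eq0 polyX_eq0 orbF lt0r_neq0. Qed.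

Lemma polyC_neq0 (c : R) : 0 < c -> c%:P != 0 :> {poly R}.
Proof. by move=> c0; rewrite polyC_eq0 lt0r_neq0. Qed.

Lemma quadratic_neq0 (w : R) : 'X^2 + w%:P != 0 :> {poly R}.
Proof. by rewrite -size_poly_eq0 size_XnaddC. Qed.

(** The admittance is s/b + w/(bs), an inerter in parallel with a spring; [w] is the square of the
    resonance frequency. *)
Lemma sp_impedance_tank (b w : R) : 0 < b -> 0 < w ->
  sp_impedance (ratfun (b *: 'X) ('X^2 + w%:P)) 2 0.
Proof.
move=> b0 w0.
have := SPI_parallel (sp_impedance_ratfunCX b 1 b0 ltr01)
                     (sp_impedance_ratfunXC b w b0 w0).
rewrite ratfun_parallel ?polyC_neq0 ?scaleX_neq0 //.
have -> : 1 *: 'X * (b *: 'X) + w%:P * b%:P = b%:P * ('X^2 + w%:P) :> {poly R}.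
  by rewrite -!mul_polyC polyC1; ring.
move/sp_impedance_ratfun_eq; apply.
- by rewrite mulf_neq0 ?polyC_neq0 // quadratic_neq0.
- exact: quadratic_neq0.
- by rewrite -!mul_polyC; ring.
Qed.

(** The admittance rt/c + (r^2/c) s is that of a damper in parallel with an inerter. *)
Lemma sp_impedance_first_order_inerter (c r t : R) : 0 < c -> 0 < r -> 0 < t ->
  sp_impedance (ratfun c%:P (r%:P * (r *: 'X + t%:P))) 1 1.
Proof.
move=> c0 r0 t0.
have := SPI_parallel (sp_impedance_ratfunC c (r * t) c0 (mulr_gt0 r0 t0))
                     (sp_impedance_ratfunCX c (r * r) c0 (mulr_gt0 r0 r0)).
rewrite ratfun_parallel ?polyC_neq0 //.
have -> : (r * t)%:P * c%:P + (r * r) *: 'X * c%:P =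
          c%:P * (r%:P * (r *: 'X + t%:P)) :> {poly R}.
  by rewrite -!mul_polyC !polyCM; ring.
have nz : r%:P * (r *: 'X + t%:P) != 0.
  by rewrite mulf_neq0 ?polyC_neq0 ?linear_neq0.
move/sp_impedance_ratfun_eq; apply=> //.
- by rewrite mulf_neq0 ?polyC_neq0.
- by ring.
Qed.

(** The admittance tr/c + t^2/(cs) is that of a damper in parallel with a spring. *)
Lemma sp_impedance_first_order_spring (c r t : R) : 0 < c -> 0 < r -> 0 < t ->
  sp_impedance (ratfun (c *: 'X) (t%:P * (r *: 'X + t%:P))) 1 1.
Proof.
move=> c0 r0 t0.
have := SPI_parallel (sp_impedance_ratfunC c (t * r) c0 (mulr_gt0 t0 r0))
                     (sp_impedance_ratfunXC c (t * t) c0 (mulr_gt0 t0 t0)).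
rewrite ratfun_parallel ?polyC_neq0 ?scaleX_neq0 //.
have -> : (t * r)%:P * (c *: 'X) + (t * t)%:P * c%:P =
          c%:P * (t%:P * (r *: 'X + t%:P)) :> {poly R}.
  by rewrite -!mul_polyC !polyCM; ring.
have nz : t%:P * (r *: 'X + t%:P) != 0.
  by rewrite mulf_neq0 ?polyC_neq0 ?linear_neq0.
move/sp_impedance_ratfun_eq; apply=> //.
- by rewrite mulf_neq0 ?polyC_neq0.
- by ring.
Qed.

(** For c = 0 no damper is inserted, hence a bound on the count. *)
Lemma sp_impedance_add_damper (Z : Defs.rational R) m n (c d : R) :
  sp_impedance Z m n -> 0 <= c -> 0 < d ->
  exists2 n', (n' <= n.+1)%N & sp_impedance (ratfun c%:P d%:P + Z) m n'.
Proof.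
move=> spZ; rewrite le_eqVlt => /orP[/eqP<- d0|c0 d0].
  by exists n => //; rewrite /ratfun tofrac0 mul0r add0r.
exists n.+1 => //.
exact: (SPI_series (sp_impedance_ratfunC c d c0 d0) spZ).
Qed.

(** The inequation excludes constants and a zero denominator. The smaller of the values at 0 and at
    infinity is split off as a series damper. *)
Lemma sp_impedance_bilinear (p q r t : R) :
  0 <= p -> 0 <= q -> 0 <= r -> 0 <= t -> p * t != q * r ->
  exists2 n, (n <= 2)%N &
    sp_impedance (ratfun (p *: 'X + q%:P) (r *: 'X + t%:P)) 1 n.
Proof.
rewrite [0 <= r]le_eqVlt [0 <= t]le_eqVlt => p_ge0 q_ge0.
move=> /orP[/eqP<-|r0] /orP[/eqP<-|t0]; rewrite ?mulr0 ?eqxx //.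
(* Case r = 0: (p/t) s + q/t, a spring and possibly a damper. *)
- rewrite mulf_eq0 negb_or => /andP[pn _].
  have p0 : 0 < p by rewrite lt_def pn.
  have [n n2 spZ] := sp_impedance_add_damper _ _ _ q t
    (sp_impedance_ratfunXC p t p0 t0) q_ge0 t0.
  exists n; first exact: leq_trans n2 _.
  move: spZ; rewrite ratfunD ?polyC_neq0 //.
  move/sp_impedance_ratfun_eq; apply.
  + by rewrite mulf_neq0 ?polyC_neq0.
  + by rewrite scale0r add0r polyC_neq0.
  + by rewrite scale0r add0r; ring.
(* Case t = 0: p/r + q/(rs), an inerter and possibly a damper. *)
- rewrite eq_sym mulf_eq0 negb_or => /andP[qn _].
  have q0 : 0 < q by rewrite lt_def qn.
  have [n n2 spZ] := sp_impedance_add_damper _ _ _ p r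
    (sp_impedance_ratfunCX q r q0 r0) p_ge0 r0.
  exists n; first exact: leq_trans n2 _.
  move: spZ; rewrite ratfunD ?polyC_neq0 ?scaleX_neq0 //.
  move/sp_impedance_ratfun_eq; apply.
  + by rewrite mulf_neq0 ?polyC_neq0 ?scaleX_neq0.
  + by rewrite addr0 scaleX_neq0.
  + by rewrite addr0 -!mul_polyC; ring.
have nz := linear_neq0 r t r0.
rewrite neq_lt => /orP[lt_pt|lt_qr].
(* Subtracting the value p/r at infinity leaves (qr - pt) / (r(rs + t)). *)
- have c0 : 0 < q * r - p * t by rewrite subr_gt0.
  have [n n2 spZ] := sp_impedance_add_damper _ _ _ p r
    (sp_impedance_first_order_inerter _ r t c0 r0 t0) p_ge0 r0.
  exists n => //.
  move: spZ; rewrite ratfunD ?mulf_neq0 ?polyC_neq0 //.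
  move/sp_impedance_ratfun_eq; apply=> //.
  + by rewrite !mulf_neq0 ?polyC_neq0.
  + by rewrite polyCB !polyCM -!mul_polyC; ring.
(* Subtracting the value q/t at 0 leaves (pt - qr) s / (t(rs + t)). *)
- have c0 : 0 < p * t - q * r by rewrite subr_gt0.
  have [n n2 spZ] := sp_impedance_add_damper _ _ _ q t
    (sp_impedance_first_order_spring _ r t c0 r0 t0) q_ge0 t0.
  exists n => //.
  move: spZ; rewrite ratfunD ?mulf_neq0 ?polyC_neq0 //.
  move/sp_impedance_ratfun_eq; apply=> //.
  + by rewrite !mulf_neq0 ?polyC_neq0.
  + by rewrite -!mul_polyC polyCB !polyCM; ring.
Qed.

End Realization.

(** * Realization when the denominator vanishes on the imaginary axis *)

Section ImaginaryPole.

Context {R : realType}.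

(** Coprimality survives the extension of scalars to the complex numbers. *)
Lemma coprime_ceval (a d : {poly R}) s :
  coprimep a d -> ceval d s = 0 -> ceval a s != 0.
Proof.
rewrite -(coprimep_map (real_complex R)) coprimep_sym => cop ds.
by apply: (coprimep_root cop); apply/eqP.
Qed.

Lemma size_cubic_le (c2 c1 c0 : R) : (size (cubic 0 c2 c1 c0) <= 3)%N.
Proof.
by apply/leq_sizeP => -[|[|[|[|i]]]] // _;
  rewrite /cubic !(coefD, coefZ, coefXn, coefX, coefC) /=;
  rewrite !(mulr0, mul0r, addr0).
Qed.

(** The imaginary part of d(iw) is w(d1 - w^2 d3) and its real part is d0 - w^2 d2. *)
Lemma imaginary_pole (d3 d2 d1 d0 w : R) : w != 0 ->
  ceval (cubic d3 d2 d1 d0) (Complex 0 w) = 0 ->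
  d1 = w ^+ 2 * d3 /\ d0 = w ^+ 2 * d2.
Proof.
move=> w0; rewrite ceval_cubic /cubic_re /cubic_im => -[re im].
split; last by apply/eqP; rewrite -subr_eq0 -re; apply/eqP; ring.
by apply: (mulIf w0); apply/eqP; rewrite -subr_eq0 -im; apply/eqP; ring.
Qed.

Lemma sp_impedance_imaginary_pole (a3 a2 a1 a0 d3 d2 d1 d0 w : R) :
  [/\ 0 <= a3, 0 <= a2, 0 <= a1 & 0 <= a0] ->
  [/\ 0 <= d3, 0 <= d2, 0 <= d1 & 0 <= d0] ->
  positive_real (cubic a3 a2 a1 a0) (cubic d3 d2 d1 d0) ->
  has_mcmillan_degree (cubic a3 a2 a1 a0) (cubic d3 d2 d1 d0) 3 ->
  w != 0 -> ceval (cubic d3 d2 d1 d0) (Complex 0 w) = 0 ->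
  exists2 n, (n <= 2)%N &
    sp_impedance (ratfun (cubic a3 a2 a1 a0) (cubic d3 d2 d1 d0)) 3 n.
Proof.
move=> [a3_ge0 a2_ge0 a1_ge0 a0_ge0] [d3_ge0 d2_ge0 _ _] pr [dn cop deg] w0 dw.
have := coprime_ceval _ _ _ cop dw; rewrite ceval_cubic => aw.
have [d1E d0E] := imaginary_pole _ _ _ _ _ w0 dw.
rewrite {}d1E {}d0E {dw} in pr dn cop deg *.
have [C_ge0 D0] := residue_condition _ _ _ _ _ _ _ w0 pr.
have w2 : 0 < w ^+ 2 by rewrite exprn_even_gt0.
(* This is |d2 + iw d3|^2; its vanishing would make the denominator zero. *)
have m0 : 0 < d2 ^+ 2 + w ^+ 2 * d3 ^+ 2.
  have d3w : 0 <= w ^+ 2 * d3 ^+ 2 by rewrite mulr_ge0 ?sqr_ge0.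
  rewrite lt_def addr_ge0 ?sqr_ge0 // andbT.
  rewrite paddr_eq0 ?sqr_ge0 // sqrf_eq0 mulf_eq0 (gt_eqF w2) /= sqrf_eq0.
  apply: contraNN dn => /andP[/eqP-> /eqP->].
  by rewrite /cubic !mulr0 !scale0r !addr0.
set C := d2 * _ - _ in C_ge0; set m := d2 ^+ 2 + _ in m0.
(* [b] is twice the residue at iw. The next three equations compare coefficients in a = bs(d3 s +
   d2) + (s^2 + w^2)(a3 s + q). *)
pose b := C / m; pose q := a0 / w ^+ 2.
have bm : b * m = C by rewrite divfK ?lt0r_neq0.
have a0E : a0 = w ^+ 2 * q by rewrite mulrC divfK ?lt0r_neq0.
have a1E : a1 = w ^+ 2 * a3 + b * d2.
  apply/eqP; rewrite -subr_eq0 -(mulIr_eq0 _ (mulIf (lt0r_neq0 m0))).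
  have -> : (a1 - (w ^+ 2 * a3 + b * d2)) * m =
            (a1 - w ^+ 2 * a3) * m - d2 * (b * m) by ring.
  (* After multiplication by [m] the difference is d3 times the left side of [D0]; for [a2] below,
     the factors are w^2 m and -d2. *)
  by apply/eqP; rewrite bm -[RHS](mulr0 d3) -D0 /C /m; ring.
have a2E : a2 = q + b * d3.
  apply/eqP; rewrite -subr_eq0.
  rewrite -(mulIr_eq0 _ (mulIf (lt0r_neq0 (mulr_gt0 w2 m0)))).
  have -> : (a2 - (q + b * d3)) * (w ^+ 2 * m) =
      w ^+ 2 * a2 * m - (w ^+ 2 * q) * m - w ^+ 2 * d3 * (b * m) by ring.
  by apply/eqP; rewrite bm -a0E -[RHS](mulr0 (- d2)) -D0 /C /m; ring.
have b_ge0 : 0 <= b by rewrite divr_ge0 // ltW.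
have q_ge0 : 0 <= q by rewrite divr_ge0 // ltW.
have b0 : 0 < b.
  (* If b = 0, then s^2 + w^2 divides the numerator, which would vanish at iw. *)
  rewrite lt_def b_ge0 andbT; apply: contraNN aw => /eqP b_eq0.
  rewrite a0E a1E a2E b_eq0 /cubic_re /cubic_im.
  by apply/eqP; congr Complex; ring.
have pq : a3 * d2 != q * d3.
  apply/eqP => e; have [d3E|d3n] := eqVneq d3 0.
    have /eqP : a3 * d2 = 0 by rewrite e d3E mulr0.
    rewrite mulf_eq0 => /orP[] /eqP z0.
      (* With a3 = d3 = 0 both degrees are at most 2; the other alternative, d2 = d3 = 0,
         contradicts m > 0. *)
      move: deg; rewrite z0 d3E mulr0 => degE.
      have := geq_max 2 (size (cubic 0 a2 a1 a0)).-1
                        (size (cubic 0 d2 0 (w ^+ 2 * d2))).-1.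
      by rewrite degE -!subn1 !leq_subLR !size_cubic_le.
    by move: m0; rewrite /m z0 d3E expr0n /= mulr0 addr0 ltxx.
  (* The proportional linear factors share the root x, which is then common to numerator and
     denominator. *)
  pose x := - d2 / d3.
  have xE : d3 * x + d2 = 0 by rewrite mulrC divfK // addNr.
  have yE : a3 * x + q = 0.
    apply: (mulIf d3n); rewrite mulrDl -e mul0r.
    transitivity (a3 * (d3 * x + d2)); first by ring.
    by rewrite xE mulr0.
  have ax : root (cubic a3 a2 a1 a0) x.
    rewrite /root /cubic a0E a1E a2E.
    rewrite !(hornerD, hornerZ, hornerXn, hornerX, hornerC); apply/eqP.
    transitivity (b * x * (d3 * x + d2) + (x ^+ 2 + w ^+ 2) * (a3 * x + q)).
      by ring.
    by rewrite xE yE !mulr0 addr0.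
  have /eqP[] := coprimep_root cop ax.
  rewrite /cubic !(hornerD, hornerZ, hornerXn, hornerX, hornerC).
  transitivity ((x ^+ 2 + w ^+ 2) * (d3 * x + d2)); first by ring.
  by rewrite xE mulr0.
have [n n2 spZ] :=
  sp_impedance_bilinear a3 q d3 d2 a3_ge0 q_ge0 d3_ge0 d2_ge0 pq.
have dn' : d3 *: 'X + d2%:P != 0.
  apply: contraNneq dn => dE; apply/eqP.
  have -> : cubic d3 d2 (w ^+ 2 * d3) (w ^+ 2 * d2) =
            ('X^2 + (w ^+ 2)%:P) * (d3 *: 'X + d2%:P).
    by rewrite /cubic -!mul_polyC !polyCM; ring.
  by rewrite dE mulr0.
exists n => //.
have := SPI_series (sp_impedance_tank b _ b0 w2) spZ.
rewrite ratfunD // ?quadratic_neq0 //.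
move/sp_impedance_ratfun_eq; apply=> //.
- by rewrite mulf_neq0 ?quadratic_neq0.
- by rewrite a0E a1E a2E /cubic -!mul_polyC !polyCD !polyCM; ring.
Qed.

End ImaginaryPole.

(** * Passage to the reciprocal and conclusion *)

(** Re (1/z) = Re z / |z|^2; at a zero of d the reciprocal is 0. *)
Lemma positive_realV {R : realType} (a d : {poly R}) :
  positive_real a d -> positive_real d a.
Proof.
move=> pr s s0 as0; have [->|/(pr s s0)] := eqVneq (ceval d s) 0.
  by rewrite mul0r.
rewrite -[ceval d s / _]invf_div; case: (_ / _) => x y /= x0.
by rewrite divr_ge0 // addr_ge0 ?sqr_ge0.
Qed.

(** The new denominator is nonzero: if a = 0, coprimality makes d a constant, of degree 0 < n. *)
Lemma has_mcmillan_degreeV {R : realType} (a d : {poly R}) n : (0 < n)%N ->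
  has_mcmillan_degree a d n -> has_mcmillan_degree d a n.
Proof.
move=> n0 [_ cop deg]; split; rewrite 1?coprimep_sym 1?maxnC //.
apply: contraTneq cop => a0; move: deg n0.
rewrite a0 size_poly0 max0n coprime0p -size_poly_eq1 => <-.
by case: size => [|[]].
Qed.

Theorem theorem1 (R : realType) (a3 a2 a1 a0 d3 d2 d1 d0 : R)
    (ha : [/\ 0 <= a3, 0 <= a2, 0 <= a1 & 0 <= a0])
    (hd : [/\ 0 <= d3, 0 <= d2, 0 <= d1 & 0 <= d0])
    (hpr : positive_real (cubic a3 a2 a1 a0) (cubic d3 d2 d1 d0))
    (hdeg : has_mcmillan_degree (cubic a3 a2 a1 a0) (cubic d3 d2 d1 d0) 3)
    (himag : exists2 w : R, w != 0 &
       is_pole (cubic a3 a2 a1 a0) (cubic d3 d2 d1 d0) (Complex 0 w) \/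
       is_zero (cubic a3 a2 a1 a0) (cubic d3 d2 d1 d0) (Complex 0 w)) :
  exists N : network R,
    [/\ well_formed N,
        series_parallel N,
        has_impedance N (ratfun (cubic a3 a2 a1 a0) (cubic d3 d2 d1 d0)),
        num_storage N = 3%N &
        (num_dampers N <= 2)%N].
Proof.
have [w w0 [dw|aw]] := himag.
  have [n n2 spZ] :=
    sp_impedance_imaginary_pole _ _ _ _ _ _ _ _ w ha hd hpr hdeg w0 dw.
  have [N [wfN spN impN sN dN]] := sp_impedance_realizable _ _ _ spZ.
  by exists N; rewrite dN.
(* A zero of Z is a pole of 1/Z; duality preserves both element counts. *)
have [n n2 spY] := sp_impedance_imaginary_pole _ _ _ _ _ _ _ _ w hd ha
  (positive_realV _ _ hpr) (has_mcmillan_degreeV _ _ 3 isT hdeg) w0 aw.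
have := sp_impedanceV _ _ _ spY; rewrite ratfunV => spZ.
have [N [wfN spN impN sN dN]] := sp_impedance_realizable _ _ _ spZ.
by exists N; rewrite dN.
Qed.
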